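(* Let $m,n,N\ge 1$ be integers. Suppose there exist $p\in(0,1)$ and nonnegative integers $c\le \frac12 m$ and $d\le\frac12 n$ for which \[ p^{\binom{m}{2}-c(c-1)}(2N)^{m-c}+(1-p)^{\binom{n}{2}-d(d-1)}(2N)^{n-d}\le\frac12 . \] Then $\tilde r(m,n)>N$.
   Context: The $(m,n)$-online Ramsey game is played by two players, Builder and Painter, on an infinite set of initially isolated vertices. Each turn, Builder places an edge between two nonadjacent vertices and Painter immediately paints it red or blue. The online Ramsey number $\tilde r(m,n)$ is the smallest number of turns $N$ within which Builder can guarantee the existence of either a red $K_m$ or a blue $K_n$, whatever Painter does. *)

(* Defs.v *)
From mathcomp Require Import all_boot all_order all_algebra.
From mathcomp Require Import boolp reals.

Set Implicit Arguments.
Unset Strict Implicit.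
Unset Printing Implicit Defensive.

Definition edge : Type := (nat * nat)%type.

Notation red := true (only parsing).
Notation blue := false (only parsing).

(* The vertex set is nat.  A board is the history of the play, latest turn
   first: each turn records the edge placed by Builder and its colour.  An edge
   is unordered; [coloured] reads both orientations. *)
Definition board : Type := seq (edge * bool).

Definition coloured (b : board) (c : bool) (u v : nat) : bool :=
  ((u, v, c) \in b) || ((v, u, c) \in b).

Definition adjacent (b : board) (u v : nat) : bool :=
  coloured b red u v || coloured b blue u v.

Definition legal_move (b : board) (e : edge) : bool :=
  (e.1 != e.2) && ~~ adjacent b e.1 e.2.

Definition has_clique (b : board) (c : bool) (k : nat) : Prop :=
  exists S : seq nat, [/\ uniq S, size S = k &
    {in S &, forall u v, u != v -> coloured b c u v}].

Definition builder_goal (m n : nat) (b : board) : Prop :=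
  has_clique b red m \/ has_clique b blue n.

Definition builder_strategy : Type := board -> edge.

(* Painter sees the history and the edge just placed. *)
Definition painter_strategy : Type := board -> edge -> bool.

(* A legal move exists on every (finite) board, so legality can be demanded on
   all boards, including those never reached. *)
Definition legal_strategy (B : builder_strategy) : Prop :=
  forall b : board, legal_move b (B b).

Fixpoint play (B : builder_strategy) (P : painter_strategy) (k : nat) : board :=
  if k is k'.+1 then
    let b := play B P k' in (B b, P b (B b)) :: b
  else [::].

Definition builder_wins_within (m n N : nat) : Prop :=
  exists B : builder_strategy, legal_strategy B /\
    forall P : painter_strategy,
      exists2 k, k <= N & builder_goal m n (play B P k).

(* Builder wins for some N: by Ramsey's theorem, completing a sufficiently
   large clique is enough. *)

Lemma ramsey (m n : nat) : exists M : nat, forall (e : rel nat) (S : seq nat),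
  symmetric e -> uniq S -> M <= size S ->
  (exists T, [/\ {subset T <= S}, uniq T, size T = m &
     {in T &, forall u v, u != v -> e u v}]) \/
  (exists T, [/\ {subset T <= S}, uniq T, size T = n &
     {in T &, forall u v, u != v -> ~~ e u v}]).
Proof.
have [k] := ubnP (m + n); elim: k => // k IH in m n *.
case: m => [|m] mn_k; first by exists 0 => e S _ _ _; left; exists [::].
case: n => [|n] in mn_k *; first by exists 0 => e S _ _ _; right; exists [::].
have [|M1 H1] := IH m n.+1; first by rewrite addSn in mn_k.
have [|M2 H2] := IH m.+1 n; first by rewrite addnS in mn_k.
exists (M1 + M2).+1 => e [|x S] //= e_sym /andP[xS uS].
rewrite ltnS -(count_predC (e x) S) => leM.
have sub (a : pred nat) : {subset filter a S <= x :: S}.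
  by move=> y; rewrite mem_filter inE => /andP[_ ->]; rewrite orbT.
have ext (r : rel nat) T j : symmetric r ->
    {subset T <= filter (r x) S} -> uniq T -> size T = j ->
    {in T &, forall u v, u != v -> r u v} ->
    exists T, [/\ {subset T <= x :: S}, uniq T, size T = j.+1 &
      {in T &, forall u v, u != v -> r u v}].
  move=> r_sym sT uT <- rT; exists (x :: T); split=> //=.
  - move=> y; rewrite inE => /orP[/eqP->|/sT/sub//]; exact: mem_head.
  - by rewrite uT andbT; apply: contra xS => /sT; rewrite mem_filter => /andP[].
  have rx y : y \in T -> r x y by move=> /sT; rewrite mem_filter => /andP[].
  move=> u v; rewrite !inE => /orP[/eqP->|uT'] /orP[/eqP->|vT'].
  - by rewrite eqxx.
  - by move=> _; apply: rx.
  - by move=> _; rewrite r_sym; apply: rx.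
  - exact: rT.
have [le1|lt1] := leqP M1 (count (e x) S).
  have [||[T [sT uT zT rT]]|[T [sT uT zT rT]]] := H1 e (filter (e x) S) e_sym.
  - exact: filter_uniq.
  - by rewrite size_filter.
  - by left; apply: ext rT.
  - by right; exists T; split=> // y /sT /sub.
have le2 : M2 <= count (predC (e x)) S.
  by rewrite -(leq_add2l M1) (leq_trans leM) // leq_add2r ltnW.
have [||[T [sT uT zT rT]]|[T [sT uT zT rT]]] := H2 e (filter (predC (e x)) S) e_sym.
- exact: filter_uniq.
- by rewrite size_filter.
- by left; exists T; split=> // y /sT /sub.
- right; apply: (ext (fun u v => ~~ e u v)) rT => // u v.
  by rewrite e_sym.
Qed.

Lemma coloured_sym (b : board) (c : bool) : symmetric (coloured b c).
Proof. by move=> u v; rewrite /coloured orbC. Qed.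

Lemma legal_move_cons (b : board) (t : edge * bool) (e : edge) :
  legal_move (t :: b) e -> legal_move b e.
Proof.
rewrite /legal_move /adjacent /coloured !inE !negb_or => /andP[->] /=.
by move=> /andP[/andP[/andP[_ ->] /andP[_ ->]] /andP[/andP[_ ->] /andP[_ ->]]].
Qed.

Lemma illegal_repeat (b : board) (c : bool) (e : edge) :
  ~~ legal_move ((e, c) :: b) e.
Proof.
case: e => u v; rewrite /legal_move /adjacent /coloured !inE /= !negb_or.
by case: c; rewrite eqxx !(andbF, andFb).
Qed.

Lemma fresh_move (b : board) : exists e, legal_move b e.
Proof.
pose k := (\max_(t <- b) maxn t.1.1 t.1.2).+1.
exists (k, k.+1); rewrite /legal_move /= neq_ltn ltnSn /=.
have kb t : t \in b -> maxn t.1.1 t.1.2 < k.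
  move=> tb; rewrite ltnS.
  exact: (@leq_bigmax_seq _ b xpredT (fun t => maxn t.1.1 t.1.2)).
apply/negP; rewrite /adjacent /coloured.
by move=> /orP[] /orP[] /kb /=; rewrite gtn_max ltnn ?andbF.
Qed.

Lemma builder_wins (m n : nat) : exists N, `[< builder_wins_within m n N >].
Proof.
have [M HM] := ramsey m n.
pose pairs := [seq (u, v) | u <- iota 0 M, v <- iota 0 M].
pose rest b := [seq e <- pairs | legal_move b e].
pose B b := head (xchoose (fresh_move b)) (rest b).
exists (size pairs); apply/asboolP; exists B; split=> [b|P].
  rewrite /B; case E: (rest b) => [|e s] /=; first exact: xchooseP.
  have : e \in rest b by rewrite E mem_head.
  by rewrite mem_filter => /andP[].
exists (size pairs) => //.
have rest_lt k : size (rest (play B P k)) <= size pairs - k.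
  elim: k => [|k IHk] /=; first by rewrite subn0 size_filter count_size.
  set b := play B P k in IHk *; set c := P _ _.
  have -> : rest ((B b, c) :: b)
          = [seq e <- rest b | legal_move ((B b, c) :: b) e].
    rewrite /rest -filter_predI; apply: eq_filter => e /=.
    by apply/idP/andP=> [H|[]//]; split=> //; apply: legal_move_cons H.
  rewrite subnS; move: IHk; rewrite /B; case: (rest b) => [|e s] //= IHk.
  rewrite (negPf (illegal_repeat _ _ _)) size_filter.
  have := leq_ltn_trans (count_size (legal_move ((e, c) :: b)) s) IHk.
  by case: (size pairs - k).
set b := play B P _.
have full u v : u < M -> v < M -> u != v -> adjacent b u v.
  move=> uM vM uv; have := rest_lt (size pairs); rewrite subnn leqn0 size_eq0.
  move=> /eqP E; apply: contraT => nadj.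
  suff : (u, v) \in rest b by rewrite E.
  rewrite mem_filter /legal_move /= uv nadj /=.
  by apply: allpairs_f; rewrite mem_iota.
have [||[T [sT uT zT rT]]|[T [sT uT zT rT]]] :=
  HM (coloured b red) (iota 0 M) (@coloured_sym b red).
- exact: iota_uniq.
- by rewrite size_iota.
- by left; exists T.
- right; exists T; split=> // u v uT' vT' uv.
  have := full u v; rewrite /adjacent (negPf (rT _ _ uT' vT' uv)) /=.
  by apply=> //; [move/sT: uT' | move/sT: vT']; rewrite mem_iota.
Qed.

Definition online_ramsey (m n : nat) : nat := ex_minn (builder_wins m n).

(* Main.v *)
(* Painter plays deterministically by the method of conditional expectations,
   derived from colouring each edge red with probability p.

   A "key" for a clique of size m consists of c turns, each revealing both
   endpoints of its edge, and of m - 2c turns, each revealing one endpoint; there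
   are at most (2N)^(m-c) keys. A turn is exposed by a key when both endpoints of
   its edge are revealed by that turn or earlier ones, which does not depend on
   the colour chosen; so under random colours, K given exposures are all red with
   probability p^K. The resulting conditional probability bounds, summed over all
   keys of both colours, form a potential that Painter can keep from increasing;
   it starts at most 1/2.

   A monochromatic clique at the end would push the potential to 1: in the clique
   take the matching of c edges with least sum of 2^turn, and for any other
   vertex its first turn in the clique. By minimality every edge between the
   matching and the rest comes after the matching edge it meets, and of the two
   perfect matchings of cross edges between two matching edges, neither lies
   entirely before the later of the two. So at most two cross edges per pair of
   matching edges, c(c-1) in all, are not exposed. *)
Require Import Defs.
From mathcomp Require Import all_boot all_order all_algebra.
From mathcomp Require Import boolp reals.
From mathcomp Require Import perm zify ring lra.
Import Order.TTheory GRing.Theory Num.Theory.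
Local Open Scope ring_scope.

Set Implicit Arguments.
Unset Strict Implicit.
Unset Printing Implicit Defensive.

Lemma card_offdiag (T : finType) :
  #|[set x : T * T | x.1 != x.2]| = (#|T| * (#|T| - 1))%N.
Proof.
have -> : [set x : T * T | x.1 != x.2] = ~: [set (x, x) | x in T].
  apply/setP => -[x y]; rewrite !inE /=; congr negb.
  by apply/eqP/imsetP => [->|[z _ [-> ->]]//]; exists y.
set A := [set (x, x) | x in T].
have cA : #|A| = #|T| by rewrite card_imset // => x y [].
have := cardsC A; rewrite cA card_prod; move: #|~: A| #|T| => k n; nia.
Qed.

(** * Matchings that are optimal under exchanges of vertices *)

Section Matching.
Local Open Scope nat_scope.
Variables (V : finType) (c : nat) (tau : V -> V -> nat).
Hypothesis tau_sym : forall x y, tau x y = tau y x.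
Implicit Type f : {ffun 'I_c * bool -> V}.

Definition pair_time f (i : 'I_c) : nat := tau (f (i, false)) (f (i, true)).

(** The ends of matching edge [i] are [f (i, false)] and [f (i, true)]. The inequalities are local
    optimality: first against replacing one end by an outside vertex, then against re-pairing two
    edges, where [s] picks one of the two re-pairings. *)
Definition stable_matching f : Prop :=
  [/\ injective f,
      forall w i s, w \notin codom f -> pair_time f i <= tau w (f (i, s)) &
      forall i j s, i != j ->
        maxn (pair_time f i) (pair_time f j) <=
        maxn (tau (f (i, false)) (f (j, s))) (tau (f (i, true)) (f (j, ~~ s)))].

Lemma exists_injection : c.*2 <= #|V| -> exists f, injectiveb f.
Proof.
move=> cV; have cX : #|{: 'I_c * bool}| <= #|V|.
  by rewrite card_prod card_ord card_bool muln2.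
exists [ffun x => enum_val (widen_ord cX (enum_rank x))].
apply/injectiveP => x y; rewrite !ffunE => /enum_val_inj /(congr1 val) /= e.
by apply: enum_rank_inj; apply: val_inj.
Qed.

Lemma exists_stable_matching : c.*2 <= #|V| -> exists f, stable_matching f.
Proof.
case/exists_injection=> f0 f0inj.
(* With weights 2 ^ time, replacing an edge by two earlier ones is a gain. *)
pose cost f := \sum_(i < c) 2 ^ pair_time f i.
pose inj (f : {ffun 'I_c * bool -> V}) := injectiveb f.
case: (@arg_minnP _ f0 inj cost f0inj) => f /injectiveP finj fmin.
pose swap x y : {ffun 'I_c * bool -> V} := [ffun z => tperm x y (f z)].
have min_swap x y : cost f <= cost (swap x y).
  apply: fmin; apply/injectiveP => u v; rewrite !ffunE => /perm_inj.
  exact: finj.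
have neqf x y : x != y -> f x != f y by apply: contra => /eqP/finj/eqP.
exists f; split=> // [w i s wf | i j s ij].
- have nw z : w != f z by apply: contra wf => /eqP->; apply: codom_f.
  (* This exchange changes edge [i] alone, into the one joining [w] to [f (i, s)]. *)
  have := min_swap w (f (i, ~~ s)).
  rewrite /cost (bigD1 i) //= [in X in _ <= X](bigD1 i) //=.
  rewrite [in X in _ <= X](eq_bigr (fun k => 2 ^ pair_time f k)) => [|k ki].
    have -> : pair_time (swap w (f (i, ~~ s))) i = tau w (f (i, s)).
      by rewrite /pair_time !ffunE; case: s;
        rewrite tpermR tpermD ?nw ?neqf ?xpair_eqE ?andbF.
    by rewrite leq_add2r leq_exp2l.
  by rewrite /pair_time !ffunE !tpermD ?nw ?neqf // xpair_eqE eq_sym (negPf ki).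
(* This exchange turns edges [i] and [j] into two cross edges between them. *)
have := min_swap (f (i, true)) (f (j, s)).
rewrite /cost (bigD1 i) //= [in X in _ <= X](bigD1 i) //=.
rewrite (bigD1 j) 1?eq_sym //= [in X in _ <= X](bigD1 j) 1?eq_sym //=.
rewrite [in X in _ <= X](eq_bigr (fun k => 2 ^ pair_time f k)); last first.
  move=> k /andP[ki kj]; rewrite /pair_time !ffunE !tpermD ?neqf //;
  by rewrite xpair_eqE [_ == k]eq_sym ?(negPf ki) ?(negPf kj).
rewrite !addnA leq_add2r.
have -> : pair_time (swap (f (i, true)) (f (j, s))) i =
          tau (f (i, false)) (f (j, s)).
  rewrite /pair_time !ffunE tpermL tpermD ?neqf // xpair_eqE ?andbF //.
  by rewrite eq_sym (negPf ij).
have -> : pair_time (swap (f (i, true)) (f (j, s))) j =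
          tau (f (i, true)) (f (j, ~~ s)).
  by rewrite /pair_time !ffunE; case: s;
     rewrite tpermR tpermD ?neqf // ?xpair_eqE ?(negPf ij) ?andbF.
set a := tau _ _; set a' := tau _ _; set d := pair_time _ _; set d' := pair_time _ _.
move=> le; rewrite leqNgt; apply/negP => lt.
have : 2 ^ a + 2 ^ a' <= 2 ^ maxn d d'.
  have : (maxn a a').+1 <= maxn d d' by [].
  rewrite -(@leq_exp2l 2) // expnS mul2n -addnn; apply: leq_trans.
  by apply: leq_add; rewrite leq_exp2l // ?leq_maxl ?leq_maxr.
have : 2 ^ maxn d d' < 2 ^ d + 2 ^ d'.
  have := expn_gt0 2 d; have := expn_gt0 2 d'.
  by case: (leqP d d') => _ /=; lia.
lia.
Qed.

(** Here [rho w] stands for the turn by which [w] is revealed. Stability leaves only cross pairs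
    between distinct matching edges as possible losses. Pairs are ordered, hence the doubling. *)
Lemma card_lost_pairs (f : {ffun 'I_c * bool -> V}) (rho : V -> nat) :
  stable_matching f ->
  (forall i s, rho (f (i, s)) = pair_time f i) ->
  (forall w v, w \notin codom f -> v != w -> rho w <= tau w v) ->
  #|[set x : V * V | (x.1 != x.2) && (tau x.1 x.2 < maxn (rho x.1) (rho x.2))]|
    <= (c * (c - 1)).*2.
Proof.
move=> [finj fout fcross] rho_in rho_out; set L := [set x | _].
pose L' := [set z : ('I_c * bool) * ('I_c * bool) | (z.1.1 != z.2.1) &&
  (tau (f z.1) (f z.2) < maxn (pair_time f z.1.1) (pair_time f z.2.1))].
have LL' : L \subset [set (f z.1, f z.2) | z in L'].
  apply/subsetP => -[a b]; rewrite !inE /= => /andP[ab lt].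
  have [/codomP[[i s] ae]|aF] := boolP (a \in codom f); last first.
    exfalso; move: lt; rewrite ltnNge geq_max rho_out 1?eq_sym //=.
    have [/codomP[[j s'] ->]|bF] := boolP (b \in codom f).
      by rewrite rho_in fout.
    by rewrite tau_sym rho_out.
  rewrite {}ae rho_in in ab lt *.
  have [/codomP[[j s'] be]|bF] := boolP (b \in codom f); last first.
    by exfalso; move: lt; rewrite ltnNge geq_max tau_sym fout ?rho_out.
  rewrite {}be rho_in in ab lt *; apply/imsetP; exists ((i, s), (j, s')) => //.
  rewrite inE /= lt andbT; apply: contraNneq ab => ij.
  rewrite -{}ij in lt *; apply/eqP; congr (f (_, _)).
  move: lt; rewrite maxnn /pair_time.
  by case: s s' => [] [] //; rewrite 1?tau_sym ltnn.
apply: leq_trans (subset_leq_card LL') _; apply: leq_trans (leq_imset_card _ _) _.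
(* At most one of the two cross matchings between two matching edges
   contributes, hence at most one lost pair of each parity. *)
pose code (z : ('I_c * bool) * ('I_c * bool)) :=
  ((z.1.1, z.2.1), z.1.2 (+) z.2.2).
have code_inj : {in L' &, injective code}.
  move=> [[i s] [j s']] [[k r] [l r']]; rewrite !inE /= => /andP[ij lt].
  move=> /andP[_ lt'] [ik jl par]; rewrite -{}ik -{}jl in lt' *.
  have {par} [[-> ->]//|[rs rs']] : (s = r /\ s' = r') \/ (r = ~~ s /\ r' = ~~ s').
    by case: s s' r r' par {lt lt'} => [] [] [] [] //=; auto.
  rewrite {}rs {}rs' in lt' *; exfalso; case: s lt lt' => /= lt lt'.
    by have := fcross i j (~~ s') ij; rewrite negbK leqNgt gtn_max lt lt'.
  by have := fcross i j s' ij; rewrite leqNgt gtn_max lt lt'.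
rewrite -(card_in_imset code_inj).
have sub : code @: L' \subset setX [set x | x.1 != x.2] setT.
  by apply/subsetP => _ /imsetP[z + ->]; rewrite !inE /= andbT => /andP[].
apply: leq_trans (subset_leq_card sub) _.
by rewrite cardsX cardsT card_bool card_offdiag card_ord muln2.
Qed.
End Matching.

(** * Boards read turn by turn *)

Definition endpoint (e : edge) (side : bool) : nat := if side then e.2 else e.1.

Definition joins (e : edge) (u v : nat) : bool := (e == (u, v)) || (e == (v, u)).

Lemma joinsC e u v : joins e u v = joins e v u.
Proof. exact: orbC. Qed.

Lemma joins_endpoint e u v : joins e u v ->
  exists side, u = endpoint e side /\ v = endpoint e (~~ side).
Proof. by case/orP => /eqP->; [exists false | exists true]. Qed.

(** Turns are numbered from 0 in order of play, hence [rev]: extending a board keeps the earlier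
    numbers. *)
Definition edge_at (b : board) (t : nat) : edge := (nth ((0, 0), red)%N (rev b) t).1.

Definition colour_at (b : board) (t : nat) : bool :=
  (nth ((0, 0), red)%N (rev b) t).2.

Lemma nth_rev_cons (T : Type) (x0 x : T) (s : seq T) (t : nat) : (t <= size s)%N ->
  nth x0 (rev (x :: s)) t = if (t < size s)%N then nth x0 (rev s) t else x.
Proof. by rewrite rev_cons nth_rcons size_rev; case: ltngtP. Qed.

Lemma edge_at_cons b x t : (t < size b)%N -> edge_at (x :: b) t = edge_at b t.
Proof. by move=> tb; rewrite /edge_at nth_rev_cons ?tb // ltnW. Qed.

Lemma edge_at_last b x : edge_at (x :: b) (size b) = x.1.
Proof. by rewrite /edge_at nth_rev_cons // ltnn. Qed.

Lemma colour_at_cons b x t : (t < size b)%N -> colour_at (x :: b) t = colour_at b t.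
Proof. by move=> tb; rewrite /colour_at nth_rev_cons ?tb // ltnW. Qed.

Lemma colour_at_last b x : colour_at (x :: b) (size b) = x.2.
Proof. by rewrite /colour_at nth_rev_cons // ltnn. Qed.

Lemma coloured_turn b col u v : coloured b col u v ->
  exists t, [/\ (t < size b)%N, joins (edge_at b t) u v & colour_at b t = col].
Proof.
have turn e : (e, col) \in b ->
    exists t, [/\ (t < size b)%N, edge_at b t = e & colour_at b t = col].
  rewrite -mem_rev => /(nthP ((0, 0), red)%N)[t]; rewrite size_rev => tb et.
  by exists t; rewrite /edge_at /colour_at et.
by case/orP=> /turn[t [tb et ct]]; exists t; split=> //; rewrite /joins et eqxx ?orbT.
Qed.

Definition turn_of (b : board) (u v : nat) : nat :=
  find (fun x => joins x.1 u v) (rev b).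

Lemma turn_ofC b u v : turn_of b u v = turn_of b v u.
Proof. by apply: eq_find => x; rewrite joinsC. Qed.

Lemma turn_ofP b col u v : coloured b col u v ->
  (turn_of b u v < size b)%N /\ joins (edge_at b (turn_of b u v)) u v.
Proof.
move=> /coloured_turn[t [tb jt _]].
have hj : has (fun x => joins x.1 u v) (rev b).
  apply/hasP; exists (nth ((0, 0), red)%N (rev b) t) => //.
  by rewrite mem_nth // size_rev.
by rewrite /turn_of -{1}(size_rev b) -has_find; split=> //; apply: (nth_find _ hj).
Qed.

Definition legal_turns (b : board) : Prop :=
  forall t, (t < size b)%N -> (edge_at b t).1 != (edge_at b t).2 /\
    forall s, (s < t)%N -> ~~ joins (edge_at b s) (edge_at b t).1 (edge_at b t).2.

Lemma size_play B P k : size (play B P k) = k.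
Proof. by elim: k => //= k ->. Qed.

Lemma play_legal B P k : legal_strategy B -> legal_turns (play B P k).
Proof.
move=> legalB; elim: k => //= k; set b := play B P k => IHk t.
rewrite /= ltnS leq_eqVlt => /predU1P[->|tb].
  rewrite edge_at_last /=; have /andP[neq nadj] := legalB b; split=> // s sb.
  rewrite edge_at_cons //; apply: contra nadj.
  have : (edge_at b s, colour_at b s) \in b.
    by rewrite -surjective_pairing -mem_rev mem_nth // size_rev.
  by rewrite /adjacent /coloured => + /orP[]/eqP <-; case: colour_at => ->;
     rewrite ?orbT.
have [neq nj] := IHk t tb; rewrite edge_at_cons //; split=> // s st.
by rewrite edge_at_cons ?nj // (ltn_trans st).
Qed.

Lemma legal_turns_inj b s t u v : legal_turns b -> (s < size b)%N ->
  (t < size b)%N -> joins (edge_at b s) u v -> joins (edge_at b t) u v -> s = t.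
Proof.
move=> legal; wlog st : s t / (s < t)%N => [W sb tb js jt|].
  by case: (ltngtP s t) => // st; [|symmetry]; apply: W.
move=> _ tb js jt; have [_ /(_ s st)] := legal t tb.
by move: jt js => /orP[]/eqP-> /=; rewrite 1?joinsC => ->.
Qed.

(** Allows an early win of Builder to be examined after exactly [N] turns. *)
Lemma has_clique_play B P k k' col j : (k <= k')%N ->
  has_clique (play B P k) col j -> has_clique (play B P k') col j.
Proof.
move=> kk' [S [uS zS hS]]; exists S; split=> // u v uS' vS' /(hS u v uS' vS').
elim: k' kk' => [|k' IH]; first by rewrite leqn0 => /eqP->.
rewrite leq_eqVlt => /predU1P[->//|/IH{}IH /IH].
by rewrite /coloured /= !inE => /orP[] ->; rewrite !orbT.
Qed.

(** * Exposed turns and their weights *)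

(** [key s side] means that turn [s] reveals that end of its edge. Turn [t] itself counts, since its
    edge is placed before Painter chooses a colour. *)
Definition known (key : nat -> bool -> bool) (E : nat -> edge) (t v : nat) : bool :=
  [exists s : 'I_t.+1, exists side, key s side && (v == endpoint (E s) side)].

Definition exposed (key : nat -> bool -> bool) (E : nat -> edge) (t : nat) : bool :=
  known key E t (E t).1 && known key E t (E t).2.

Lemma eq_exposed key E E' t : (forall s, (s <= t)%N -> E s = E' s) ->
  exposed key E t = exposed key E' t.
Proof.
move=> EE'; have eqk v : known key E t v = known key E' t v.
  by apply: eq_existsb => s; apply: eq_existsb => side; rewrite EE' // -ltnS.
by rewrite /exposed EE' // !eqk.
Qed.

Section Weight.
Variable R : realFieldType.
Implicit Types (q : R) (col : bool) (key : nat -> bool -> bool).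

(** A martingale when turns get colour [col] independently with probability [q]; times [q ^+ K] it
    bounds the conditional probability that [K] exposed turns all get [col]. *)
Definition weight q col key (b : board) : R :=
  \prod_(t < size b)
    if exposed key (edge_at b) t then (if colour_at b t == col then q^-1 else 0)
    else 1.

(** The [red] on the right is arbitrary, as exposure ignores colours; fixing it gives both colours
    of the new turn the same condition. *)
Lemma weight_cons q col key e col' b : weight q col key ((e, col') :: b) =
  weight q col key b *
  if exposed key (edge_at ((e, red) :: b)) (size b)
  then (if col' == col then q^-1 else 0) else 1.
Proof.
rewrite /weight big_ord_recr /= colour_at_last /=; congr (_ * _).
  apply: eq_bigr => t _; rewrite colour_at_cons //.
  rewrite (@eq_exposed _ _ (edge_at b)) // => s st.
  by rewrite edge_at_cons // (leq_ltn_trans st).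
rewrite (@eq_exposed _ _ (edge_at ((e, red) :: b))) // => s.
rewrite leq_eqVlt => /predU1P[->|st]; first by rewrite !edge_at_last.
by rewrite !edge_at_cons.
Qed.

Lemma weight_fair q col key e b : q != 0 ->
  q * weight q col key ((e, col) :: b) +
  (1 - q) * weight q col key ((e, ~~ col) :: b) = weight q col key b.
Proof.
move=> q0; rewrite !weight_cons eqxx [~~ _ == _]eq_sym; case: exposed; last by ring.
by case: col => /=; field.
Qed.

Lemma weight_ge0 q col key b : 0 <= q -> 0 <= weight q col key b.
Proof.
by move=> q0; apply: prodr_ge0 => t _; do 2?case: ifP => // _; rewrite invr_ge0.
Qed.

Lemma weight_exposed q col key b :
  (forall t, (t < size b)%N -> exposed key (edge_at b) t -> colour_at b t = col) ->
  weight q col key b = q^-1 ^+ #|[set t : 'I_(size b) | exposed key (edge_at b) t]|.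
Proof.
move=> hcol; rewrite -prodr_const [RHS]big_mkcond /=; apply: eq_bigr => t _.
by rewrite inE; case: ifP => // /hcol -> //; rewrite eqxx.
Qed.
End Weight.

(* The Boolean of the first c entries is ignored: with it, the number of keys is
   exactly (2N)^(m-c). *)
Definition key_of (N : nat) (c : nat) (F : seq ('I_N * bool))
    (t : nat) (side : bool) : bool :=
  has (fun x => val x.1 == t) (take c F) ||
  has (fun x => (val x.1 == t) && (x.2 == side)) (drop c F).

(** * The key of a monochromatic clique *)

Section Clique.
Local Open Scope nat_scope.

(** The key built from a stable matching reveals clique vertices only, so exposed turns lie in the
    clique and have its colour. Each vertex [w] is known by turn [rho w], so every pair that is not
    lost is exposed. *)
Lemma exists_vertex_key b col (S : seq nat) c :
  legal_turns b -> {in S &, forall u v, u != v -> coloured b col u v} ->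
  uniq S -> 1 < size S -> c.*2 <= size S ->
  exists F : (size S - c).-tuple ('I_(size b) * bool),
    (forall t, t < size b -> exposed (key_of c F) (edge_at b) t ->
       colour_at b t = col) /\
    'C(size S, 2) - c * (c - 1) <=
      #|[set t : 'I_(size b) | exposed (key_of c F) (edge_at b) t]|.
Proof.
move=> legal hS uS S1 cS; set E := edge_at b; set N := size b.
pose V := seq_sub S; pose tau (u v : V) := turn_of b (val u) (val v).
have cardV : #|{: V}| = size S by apply: card_seq_sub.
have tau_sym u v : tau u v = tau v u by apply: turn_ofC.
have tauP (u v : V) : u != v -> tau u v < N /\ joins (E (tau u v)) (val u) (val v).
  by move=> uv; apply: (@turn_ofP _ col); apply: hS (valP u) (valP v) _.
have [|f stab] := @exists_stable_matching V c tau tau_sym; first by rewrite cardV.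
have [finj _ _] := stab.
have pair_lt i : pair_time tau f i < N.
  by have [] // := tauP (f (i, false)) (f (i, true)); apply/eqP => /finj.
have labP (w : V) : exists x : 'I_N * bool, endpoint (E x.1) x.2 = val w /\
    forall v, v != w -> x.1 <= tau w v.
  have [v0 v0w] : exists v0, v0 != w.
    apply/existsP; rewrite -negb_forall; apply: contraL S1 => /forallP allw.
    rewrite -leqNgt -cardV -(card1 w); apply: subset_leq_card.
    by apply/subsetP => v _; rewrite inE; exact: allw.
  case: (@arg_minnP _ v0 (fun v => v != w) (tau w) v0w) => v vw vmin.
  have [|lt jn] := tauP w v; first by rewrite eq_sym.
  have [side [ew _]] := joins_endpoint jn.
  by exists (Ordinal lt, side).
have [lab {}labP] := fin_all_exists labP.
pose rho w := if [pick z | f z == w] is Some z then pair_time tau f z.1 else (lab w).1.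
have rho_in i s : rho (f (i, s)) = pair_time tau f i.
  rewrite /rho; case: pickP => [z /eqP/finj-> //|/(_ (i, s))]; by rewrite eqxx.
have rho_out w : w \notin codom f -> rho w = (lab w).1.
  rewrite /rho; case: pickP => // z /eqP <-; by rewrite codom_f.
(* The [true] is a filler; the length is [c] plus the [size S - c.*2] unmatched vertices. *)
pose F0 := [seq (Ordinal (pair_lt i), true) | i <- enum 'I_c] ++
  [seq lab w | w <- enum [predC codom f]].
have sizeF : size F0 == size S - c.
  have := cardC (mem (codom f)); rewrite card_codom // card_prod card_ord card_bool.
  rewrite cardV size_cat 2!size_map size_enum_ord -cardE.
  have -> : #|[predC mem (codom f)]| = #|[predC codom f]| by [].
  move: #|[predC codom f]| => k; lia.
pose F := Tuple sizeF; exists F; set key := key_of c F.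
have keyP t s : reflect ((exists i, pair_time tau f i = t) \/
    (exists2 w, w \notin codom f & (lab w).1 = t :> nat /\ (lab w).2 = s)) (key t s).
  rewrite /key /key_of /= take_size_cat ?drop_size_cat 1?size_map ?size_enum_ord //.
  rewrite 2!has_map; apply: (iffP orP) => -[].
  - by case/hasP=> i _ /eqP ti; left; exists i.
  - case/hasP=> w; rewrite mem_enum /= => wf /andP[/eqP tw /eqP sw].
    by right; exists w.
  - by case=> i ti; left; apply/hasP; exists i; [rewrite mem_enum | apply/eqP].
  - case=> w wf [tw sw]; right; apply/hasP; exists w; first by rewrite mem_enum.
    by rewrite /= tw sw !eqxx.
have known_rho (w : V) t : rho w <= t -> known key E t (val w).
  have [/codomP[[i s] ->]|wf] := boolP (w \in codom f).
    rewrite rho_in => it; have ij : f (i, false) != f (i, true) by apply/eqP => /finj.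
    have [_ /joins_endpoint[side [e0 e1]]] := tauP _ _ ij.
    have it' : pair_time tau f i < t.+1 by [].
    apply/existsP; exists (Ordinal it'); apply/existsP.
    exists (if s then ~~ side else side); apply/andP; split.
      by apply/keyP; left; exists i.
    by case: s; rewrite ?e0 ?e1.
  rewrite rho_out // -ltnS => wt; apply/existsP; exists (Ordinal wt); apply/existsP.
  exists (lab w).2; rewrite /= (labP w).1 eqxx andbT; apply/keyP.
  by right; exists w.
have known_in t v : known key E t v -> v \in S.
  case/existsP=> s /existsP[side /andP[/keyP[[i ti]|[w wf [tw sw]]] /eqP->]].
    have ij : f (i, false) != f (i, true) by apply/eqP => /finj.
    have [_ jn] := tauP _ _ ij; move: jn; rewrite -[tau _ _]/(pair_time tau f i) ti.
    by case/orP=> /eqP->; case: side; apply: valP.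
  by rewrite -tw -sw (labP w).1; apply: valP.
have exposed_clique t : t < N -> exposed key E t -> coloured b col (E t).1 (E t).2.
  move=> tN /andP[/known_in uS' /known_in vS'].
  by apply: hS => //; have [] := legal t tN.
split=> [t tN et|].
  (* Some turn gives this pair the colour [col]; by legality it can only be [t]. *)
  have [t' [t'N jn' <-]] := coloured_turn (exposed_clique t tN et).
  congr colour_at; apply: (legal_turns_inj legal tN t'N _ jn').
  by rewrite /joins -surjective_pairing eqxx.
set X := [set t | _].
(* Ordered pairs are counted, two per turn, and the total is halved at the end. *)
set D := [set x : V * V | x.1 != x.2].
set L := [set x : V * V | (x.1 != x.2) && (tau x.1 x.2 < maxn (rho x.1) (rho x.2))].
have cardL : #|L| <= (c * (c - 1)).*2.
  apply: (card_lost_pairs tau_sym stab rho_in) => w v wf vw.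
  by rewrite rho_out // (labP w).2.
have cardD : #|D| = size S * (size S - 1) by rewrite /D card_offdiag cardV.
have cardDL : #|D :\: L| <= #|X|.*2.
  (* Pairs that are not lost are read off exposed turns with an orientation. Options are needed
     because [h] is defined on all turns, whose ends may lie outside the clique. *)
  pose g (x : V * V) := (Some x.1, Some x.2).
  have g_inj : injective g by move=> [x1 x2] [y1 y2] [-> ->].
  pose h (y : 'I_N * bool) : option V * option V :=
    (insub (endpoint (E y.1) y.2), insub (endpoint (E y.1) (~~ y.2))).
  have sub : g @: (D :\: L) \subset h @: setX X setT.
    apply/subsetP => _ /imsetP[[u v] uvD ->].
    move: uvD; rewrite !inE /= => /andP[+ uv]; rewrite uv -leqNgt geq_max.
    move=> /andP[ut vt]; have [tN jt] := tauP u v uv.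
    have [side [eu ev]] := joins_endpoint jt.
    apply/imsetP; exists (Ordinal tN, side).
      rewrite !inE andbT /exposed /=.
      have ku := known_rho _ _ ut; have kv := known_rho _ _ vt.
      by move: jt ku kv => /orP[]/eqP/= -> /= -> ->.
    by rewrite /h /= -eu -ev !valK.
  rewrite -(card_imset _ g_inj); apply: leq_trans (subset_leq_card sub) _.
  by apply: leq_trans (leq_imset_card _ _) _; rewrite cardsX cardsT card_bool muln2.
have := cardsID L D; have := subset_leq_card (subsetIr D L).
have := bin2 (size S); rewrite -divn2; move: ('C(_, _)) => C2 ->.
rewrite cardD => le1 e1.
have : size S * (size S - 1) <= (c * (c - 1)).*2 + #|X|.*2.
  rewrite -e1; apply: leq_add => //; exact: leq_trans le1 cardL.
rewrite subn1 -doubleD divn2 => /half_leq; rewrite doubleK; lia.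
Qed.
End Clique.

(** The weight is [q^-1] to the number of exposed turns, which is at least the exponent of [q], and
    [q < 1]. *)
Lemma clique_weight (R : realFieldType) (q : R) b col m c :
  0 < q < 1 -> legal_turns b -> has_clique b col m -> (1 < m)%N ->
  (c.*2 <= m)%N ->
  exists F : (m - c).-tuple ('I_(size b) * bool),
    1 <= q ^+ ('C(m, 2) - c * (c - 1)) * weight q col (key_of c F) b.
Proof.
move=> /andP[q0 q1] legal [S [uS <- hS]] m1 cm.
have [F [hcol hX]] := exists_vertex_key legal hS uS m1 cm; exists F.
rewrite (weight_exposed q hcol) exprVn -ler_pdivrMr ?invr_gt0 ?exprn_gt0 //.
by rewrite invrK mul1r ler_wiXn2l // ltW.
Qed.

(** * The potential and Painter's strategy *)

Section Painter.
Variables (R : realFieldType) (p : R) (m n c d N : nat).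

Definition potential (b : board) : R :=
  \sum_(F : (m - c).-tuple ('I_N * bool))
    p ^+ ('C(m, 2) - c * (c - 1)) * weight p red (key_of c F) b +
  \sum_(F : (n - d).-tuple ('I_N * bool))
    (1 - p) ^+ ('C(n, 2) - d * (d - 1)) * weight (1 - p) blue (key_of d F) b.

Definition painter (b : board) (e : edge) : bool :=
  potential ((e, red) :: b) <= potential b.

Hypothesis p01 : 0 < p < 1.

Lemma potential_nil : potential [::] =
  p ^+ ('C(m, 2) - c * (c - 1)) * (2 * N%:R) ^+ (m - c) +
  (1 - p) ^+ ('C(n, 2) - d * (d - 1)) * (2 * N%:R) ^+ (n - d).
Proof.
have sum_keys (q : R) col e k j :
    \sum_(F : j.-tuple ('I_N * bool)) q ^+ e * weight q col (key_of k F) [::] =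
    q ^+ e * (2 * N%:R) ^+ j.
  under eq_bigr do rewrite /weight big_ord0 mulr1.
  rewrite sumr_const card_tuple card_prod card_ord card_bool -[LHS]mulr_natr natrX.
  by rewrite natrM [2 * _]mulrC.
by rewrite /potential !sum_keys.
Qed.

Lemma potential_fair b e :
  p * potential ((e, red) :: b) + (1 - p) * potential ((e, blue) :: b) = potential b.
Proof.
have [p0 p1] := andP p01; have q0 : 1 - p != 0 by rewrite subr_eq0 gt_eqF.
rewrite /potential !mulrDr addrACA; congr (_ + _);
  rewrite !mulr_sumr -big_split /=; apply: eq_bigr => F _.
  by rewrite -[in RHS](@weight_fair _ p red _ e) ?gt_eqF //; ring.
by rewrite -[in RHS](@weight_fair _ (1 - p) blue _ e) //; ring.
Qed.

(** The current potential is a weighted average of the two outcomes, so if red raises it, blue does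
    not. *)
Lemma potential_painter b e : potential ((e, painter b e) :: b) <= potential b.
Proof.
have [p0 p1] := andP p01; rewrite /painter.
case: (leP (potential ((e, red) :: b)) (potential b)) => // lt.
rewrite -(@ler_pM2l _ (1 - p)) ?subr_gt0 //.
have := potential_fair b e; have : p * potential b < p * potential ((e, red) :: b).
  by rewrite ltr_pM2l.
by move=> ? ?; lra.
Qed.

Lemma potential_play B k : potential (play B painter k) <= potential [::].
Proof. by elim: k => //= k; apply: le_trans (potential_painter _ _). Qed.

Lemma potential_goal b : legal_turns b -> size b = N ->
  (1 < m)%N -> (1 < n)%N -> (c.*2 <= m)%N -> (d.*2 <= n)%N ->
  builder_goal m n b -> 1 <= potential b.
Proof.
have [p0 p1] := andP p01; move=> legal sb m1 n1 cm dn.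
have q01 : 0 < 1 - p < 1 by apply/andP; split; lra.
have [q0 _] := andP q01.
have pos q col e j k (Fs : {pred j.-tuple ('I_N * bool)}) : 0 <= q ->
   0 <= \sum_(F : j.-tuple ('I_N * bool) | Fs F) q ^+ e * weight q col (key_of k F) b.
  by move=> q_ge0; apply: sumr_ge0 => F _; rewrite mulr_ge0 ?exprn_ge0 ?weight_ge0.
case=> cl.
  have := clique_weight p01 legal cl m1 cm; rewrite sb => -[F hF].
  rewrite /potential (bigD1 F) //= -addrA; apply: le_trans hF _.
  by rewrite lerDl addr_ge0 // pos // ltW.
have := clique_weight q01 legal cl n1 dn; rewrite sb => -[F hF].
rewrite /potential [in X in _ + X](bigD1 F) //= addrCA; apply: le_trans hF _.
by rewrite lerDl addr_ge0 // pos // ltW.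
Qed.
End Painter.

(** * The lower bound *)

Unset Implicit Arguments.

Theorem theorem1 (R : realType) (m n N : nat)
  (hm : (1 <= m)%N) (hn : (1 <= n)%N) (hN : (1 <= N)%N)
  (hp : exists (p : R) (c d : nat),
    [/\ 0 < p < 1, c%:R <= 1 / 2 * m%:R :> R, d%:R <= 1 / 2 * n%:R :> R &
        p ^+ ('C(m, 2) - c * (c - 1)) * (2 * N%:R) ^+ (m - c)
        + (1 - p) ^+ ('C(n, 2) - d * (d - 1)) * (2 * N%:R) ^+ (n - d)
        <= 1 / 2]) :
  (N < online_ramsey m n)%N.
Proof.
case: hp => p [c [d [p01 cm dn]]]; have [p0 p1] := andP p01.
have half (k j : nat) : k%:R <= 1 / 2 * j%:R :> R -> (k.*2 <= j)%N.
  by move=> kj; rewrite -(ler_nat R) -muln2 natrM; lra.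
have {}cm := half _ _ cm; have {}dn := half _ _ dn.
have N2 : 2 <= 2 * N%:R :> R by rewrite ler_peMr // ler1n.
(* For [j = 1] the constraint forces [k = 0], and the term becomes [2 * N], too large. *)
have gt1 (q : R) k j : 0 < q -> (k.*2 <= j)%N ->
    q ^+ ('C(j, 2) - k * (k - 1)) * (2 * N%:R) ^+ (j - k) <= 1 / 2 -> (1 <= j)%N ->
    (1 < j)%N.
  case: j => [|[|j]] // q0; case: k => // _; rewrite mul0n bin_small // mul1r expr1.
  lra.
have keys_ge0 (q : R) e j : 0 < q -> 0 <= q ^+ e * (2 * N%:R) ^+ j.
  by move=> q0; rewrite mulr_ge0 ?exprn_ge0 //; lra.
move=> start; have q0 : 0 < 1 - p by lra.
have m1 : (1 < m)%N.
  apply: (gt1 p c) => //.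
  by have := keys_ge0 (1 - p) ('C(n, 2) - d * (d - 1))%N (n - d)%N q0; lra.
have n1 : (1 < n)%N.
  apply: (gt1 (1 - p) d) => //.
  by have := keys_ge0 p ('C(m, 2) - c * (c - 1))%N (m - c)%N p0; lra.
rewrite /online_ramsey; case: ex_minnP => M /asboolP[B [legalB win]] _.
rewrite ltnNge; apply/negP => MN.
have [k kM goal] := win (painter p m n c d N).
have {}goal : builder_goal m n (play B (painter p m n c d N) N).
  by case: goal => /(has_clique_play (leq_trans kM MN)); [left | right].
have legal : legal_turns (play B (painter p m n c d N) N) by apply: play_legal.
(* The win makes the potential at least 1, although it began at most [1 / 2] and never rose. *)
have := potential_goal p01 legal (size_play _ _ _) m1 n1 cm dn goal.
have := potential_play m n c d N p01 B N.
rewrite potential_nil; lra.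
Qed.
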